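(* Consider the on-line majority edge-colouring game in which the only restriction on the Presenter is that the final graph has minimum degree at least $2$. The Algorithm has a strategy using at most five colours against any strategy of the Presenter. That is, there is an on-line strategy for the Algorithm that uses colours from a fixed set of five colours and such that, whatever the Presenter does, the colouring of the final graph is a majority edge-colouring.
   Context: All graphs are finite and simple. A majority edge-colouring of a graph $G$ is a (not necessarily proper) colouring of the edges of $G$ such that, for every vertex $v$ of $G$ and every colour $c$, at most $d_G(v)/2$ of the edges incident with $v$ have colour $c$. On-line game: two players, the Presenter and the Algorithm, start with an edgeless graph. In each round the Presenter reveals one new edge, possibly using previously unused vertices; its endpoints are identified to the Algorithm. The Algorithm must immediately and irrevocably assign a colour to this edge, knowing only the part of the graph revealed so far and its colouring. The Presenter may choose each edge depending on the whole history of the game, including all colours assigned so far. After finitely many rounds the Presenter ends the game; the graph formed by all revealed edges is the final graph (it has no vertices of degree $0$), and it must satisfy the stated restriction. The Algorithm does not know the final graph in advance. The Algorithm's goal is that the resulting colouring of the final graph is a majority edge-colouring. *)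

(* Defs.v *)
From HB Require Import structures.
From mathcomp Require Import all_boot finmap.
Set Implicit Arguments.
Unset Strict Implicit.
Unset Printing Implicit Defensive.
Local Open Scope fset_scope.
Local Open Scope fmap_scope.
Local Open Scope nat_scope.

(* Vertices are drawn from an arbitrary choiceType V; only
   finitely many of them occur in any position of the game. *)

Definition edge (V : choiceType) : choiceType := {e : {fset V} | #|` e| == 2}.

(* A finite simple graph without isolated vertices is given by its edge set. *)
Definition graph (V : choiceType) := {fset edge V}.

Definition vertices (V : choiceType) (E : graph V) : {fset V} :=
  \bigcup_(e <- E) val e.

Definition degree (V : choiceType) (E : graph V) (v : V) : nat :=
  #|` [fset e in E | v \in val e]|.

Definition min_degree_geq (V : choiceType) (k : nat) (E : graph V) : Prop :=
  forall v : V, v \in vertices E -> k <= degree E v.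

(* An edge-coloured graph: the domain of the map is the edge set. *)
Definition coloured_graph (V : choiceType) (C : eqType) := {fmap edge V -> C}.

Definition colour_degree (V : choiceType) (C : eqType)
    (G : coloured_graph V C) (v : V) (c : C) : nat :=
  #|` [fset e in domf G | (v \in val e) && (G.[? e] == Some c)]|.

Definition majority_edge_colouring (V : choiceType) (C : eqType)
    (G : coloured_graph V C) : Prop :=
  forall (v : V) (c : C), v \in vertices (domf G) ->
    2 * colour_degree G v c <= degree (domf G) v.

(* The rounds played so far, the oldest first. *)
Definition history (V : choiceType) (C : eqType) := seq (edge V * C).

Definition position (V : choiceType) (C : eqType) (h : history V C) :
    coloured_graph V C :=
  foldl (fun (G : coloured_graph V C) ec => G.[ec.1 <- ec.2]) [fmap] h.

(* The Algorithm sees the coloured graph revealed so far and the new edge. *)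
Definition algorithm (V : choiceType) (C : eqType) :=
  coloured_graph V C -> edge V -> C.

(* The Presenter sees the whole history; the answer None ends the game. *)
Definition presenter (V : choiceType) (C : eqType) :=
  history V C -> option (edge V).

Definition next_round (V : choiceType) (C : eqType)
    (A : algorithm V C) (P : presenter V C) (h : history V C) : history V C :=
  if P h is Some e then rcons h (e, A (position h) e) else h.

Definition play (V : choiceType) (C : eqType)
    (A : algorithm V C) (P : presenter V C) (n : nat) : history V C :=
  iter n (next_round A P) [::].

Definition reveals_new_edges (V : choiceType) (C : eqType)
    (A : algorithm V C) (P : presenter V C) : Prop :=
  forall (n : nat) (e : edge V),
    P (play A P n) = Some e -> e \notin domf (position (play A P n)).

Definition final_position (V : choiceType) (C : eqType)
    (A : algorithm V C) (P : presenter V C) (G : coloured_graph V C) : Prop :=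
  exists n : nat, P (play A P n) = None /\ G = position (play A P n).

(* Main.v *)
Require Import Defs.
From mathcomp Require Import all_boot finmap.

(** The Algorithm plays greedily. Call a colour saturated at [v] if giving it
    to one more edge at [v] would create too many edges of that colour there.
    A saturated colour occurs at [v], on at least half of the edges there, and
    every edge has only one colour, so at most two colours are saturated at [v]
    ([card_saturated]). A new edge has two ends, hence at most four colours are
    bad for it, and one of the five is free ([free_colour]).

    Too many cannot mean more than half: the first edge at a vertex already has
    all of the degree in its colour. What greedy play maintains is that each
    colour has at most [max (2, d) / 2] edges at a vertex of degree [d]
    ([balanced]), which is the majority condition once [d] is at least two. *)

Set Implicit Arguments.
Unset Strict Implicit.
Unset Printing Implicit Defensive.
Local Open Scope fset_scope.
Local Open Scope fmap_scope.
Local Open Scope nat_scope.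

Lemma card_fset_sep (K : choiceType) (E : {fset K}) (p : pred K) :
  #|` [fset e in E | p e]| = \sum_(e <- E) p e.
Proof.
rewrite -big_mkcond sum1_count -size_filter; apply/perm_size/uniq_perm.
- exact: fset_uniq.
- exact/filter_uniq/fset_uniq.
by move=> e; rewrite mem_filter !inE andbC.
Qed.

Section ColourDegrees.
Variables (V : choiceType) (C : eqType).
Implicit Types (G : coloured_graph V C) (e : edge V) (v : V) (c : C).

Lemma colour_degree_setf G e c v c' : e \notin domf G ->
  colour_degree G.[e <- c] v c'
    = ((v \in val e) && (c == c')) + colour_degree G v c'.
Proof.
move=> eG; rewrite /colour_degree !card_fset_sep.
under eq_bigr do rewrite fnd_set.
rewrite dom_setf big_fsetU1 //= eqxx (inj_eq Some_inj); congr (_ + _).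
by apply: eq_big_seq => f fG; case: (f =P e) => // fe; rewrite -fe fG in eG.
Qed.

Lemma degree_setf G e c v : e \notin domf G ->
  degree (domf G.[e <- c]) v = (v \in val e) + degree (domf G) v.
Proof. by move=> eG; rewrite /degree !card_fset_sep dom_setf big_fsetU1. Qed.

Definition balanced G : Prop :=
  forall v c, 2 * colour_degree G v c <= maxn 2 (degree (domf G) v).

(** One more edge of colour [c] at [v] keeps the bound of [balanced] when
    [2 * k.+1 <= maxn 2 d.+1], which amounts to [2 * k < maxn 1 d]; this is the
    negation. *)
Definition saturated G v c : bool :=
  maxn 1 (degree (domf G) v) <= 2 * colour_degree G v c.

Lemma balanced_setf G e c : e \notin domf G -> balanced G ->
  (forall v, v \in val e -> ~~ saturated G v c) -> balanced G.[e <- c].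
Proof.
move=> eG balG unsat v c'; rewrite colour_degree_setf // degree_setf //.
have := balG v c'; case: (boolP (v \in val e)) => [ve | _] //=.
case: eqP => [<- _ | _ le_c'] /=.
  have := unsat v ve; rewrite /saturated -ltnNge => lt_c.
  by rewrite mulnDr muln1 add1n addSn (maxnSS 1) add1n ltnS.
by apply: leq_trans le_c' _; rewrite geq_max leq_maxl leq_max leqnSn orbT.
Qed.

Lemma balanced_majority G :
  balanced G -> min_degree_geq 2 (domf G) -> majority_edge_colouring G.
Proof.
by move=> balG min2 v c vG; rewrite -(maxn_idPr (min2 v vG)); apply: balG.
Qed.

End ColourDegrees.

Lemma sum_colour_degree (V : choiceType) (C : finType)
    (G : coloured_graph V C) v :
  \sum_(c : C) colour_degree G v c = degree (domf G) v.
Proof.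
under eq_bigr do rewrite /colour_degree card_fset_sep.
rewrite exchange_big /degree card_fset_sep; apply: eq_big_seq => e eG /=.
rewrite (in_fnd eG) (bigD1 (G [` eG])) //= eqxx andbT big1 ?addn0 // => c.
by rewrite eq_sym (inj_eq Some_inj) => /negPf ->; rewrite andbF.
Qed.

(** If [k] colours are saturated at a vertex of degree [d], counting their edges
    gives [k * maxn 1 d <= 2 * d]; the maximum covers the case [d = 0]. *)
Lemma card_saturated (V : choiceType) (C : finType)
    (G : coloured_graph V C) v : #|[set c | saturated G v c]| <= 2.
Proof.
set d := maxn 1 (degree (domf G) v).
have d_gt0 : 0 < d by rewrite leq_maxl.
rewrite -(leq_pmul2r d_gt0) -sum_nat_const.
apply: (@leq_trans (\sum_(c : C) 2 * colour_degree G v c)).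
  rewrite [leqRHS](bigID (mem [set c | saturated G v c])) /=.
  by apply/leq_trans/leq_addr/leq_sum => c; rewrite inE.
by rewrite -big_distrr sum_colour_degree leq_pmul2l ?leq_maxr.
Qed.

Lemma free_colour (V : choiceType) (C : finType)
    (G : coloured_graph V C) (e : edge V) : 4 < #|C| ->
  exists c, all (fun v => ~~ saturated G v c) (val e).
Proof.
move=> C_gt4; have: size (val e) == 2 := valP e.
case: (enum_fset (val e)) => [|x [|y []]] //= _.
pose bad := [set c | saturated G x c] :|: [set c | saturated G y c].
have /card_gt0P[c] : 0 < #|~: bad|.
  rewrite cardsCs setCK subn_gt0; apply: leq_ltn_trans C_gt4.
  apply: leq_trans (leq_card_setU _ _) _.
  exact: (leq_add (card_saturated G x) (card_saturated G y)).
rewrite !inE negb_or => /andP[free_x free_y].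
by exists c; rewrite free_x free_y.
Qed.

(** The default colour is never used, by [free_colour]. *)
Definition greedy (V : choiceType) : algorithm V 'I_5 :=
  fun G e => odflt ord0 [pick c | all (fun v => ~~ saturated G v c) (val e)].

Lemma greedy_unsaturated (V : choiceType) (G : coloured_graph V 'I_5)
    (e : edge V) v : v \in val e -> ~~ saturated G v (greedy G e).
Proof.
rewrite /greedy; case: pickP => [c /allP free_c | none]; first exact: free_c.
have [|c] := @free_colour V 'I_5 G e; first by rewrite card_ord.
by rewrite none.
Qed.

Lemma balanced_greedy_play (V : choiceType) (P : presenter V 'I_5) n :
  reveals_new_edges (@greedy V) P -> balanced (position (play (@greedy V) P n)).
Proof.
move=> newP; elim: n => [|n IHn].
  by move=> v c; rewrite /colour_degree card_fset_sep /= big_seq_fset0.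
rewrite /play iterS -/(play _ _ n) /next_round.
case Pn: (P _) => [e|] //; rewrite /position foldl_rcons -/(position _) /=.
apply: balanced_setf => //; first exact: newP Pn.
by move=> v; apply: greedy_unsaturated.
Qed.

Theorem theorem2 (V : choiceType) :
  exists A : algorithm V 'I_5,
    forall (P : presenter V 'I_5) (G : coloured_graph V 'I_5),
      reveals_new_edges A P ->
      final_position A P G ->
      min_degree_geq 2 (domf G) ->
      majority_edge_colouring G.
Proof.
exists (@greedy V) => P G newP [n [_ ->]].
exact/balanced_majority/balanced_greedy_play.
Qed.
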